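(* Let $(X,\mathcal{B},\mu,T)$ be a measure preserving system. Then $(X,\mathcal{B},\mu,T)$ is weak mixing if and only if for every $\epsilon>0$ and all $A,B\in\mathcal{B}$, the set $$N_{\epsilon}(A,B)=\left\{n\in\mathbb{N}:\left|\mu(A\cap T^{-n}B)-\mu(A)\mu(B)\right|<\epsilon\right\}$$ is a $C^{\star}$-set in $(\mathbb{N},+)$.
   Context: $\mathbb{N}$ is the set of positive integers and $\mathcal{P}_f(\mathbb{N})$ is the set of nonempty finite subsets of $\mathbb{N}$. Measure preserving system: a quadruple $(X,\mathcal{B},\mu,T)$ where $(X,\mathcal{B},\mu)$ is a probability space and $T:X\to X$ satisfies $T^{-1}B\in\mathcal{B}$ and $\mu(T^{-1}B)=\mu(B)$ for all $B\in\mathcal{B}$; $T^{-n}B$ denotes the preimage of $B$ under $T^n$. $\beta\mathbb{N}$ is the set of ultrafilters on $\mathbb{N}$ (Stone–Čech compactification of discrete $\mathbb{N}$), with the operation $A\in p+q$ iff $\{x\in\mathbb{N}:-x+A\in q\}\in p$, where $-x+A=\{y\in\mathbb{N}:x+y\in A\}$; it is a compact right topological semigroup, and $K(\beta\mathbb{N})$ is its smallest two-sided ideal. An idempotent is $p$ with $p+p=p$. A set $A\subseteq\mathbb{N}$ is central if $A\in p$ for some idempotent $p\in K(\beta\mathbb{N})$; it is a central$^{\star}$-set if it meets every central set (equivalently, it belongs to every idempotent in $K(\beta\mathbb{N})$). A set $A\subseteq\mathbb{N}$ is a $J$-set if for every nonempty finite set $F$ of functions $\mathbb{N}\to\mathbb{N}$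 there exist $a\in\mathbb{N}$ and $H\in\mathcal{P}_f(\mathbb{N})$ such that $a+\sum_{n\in H}f(n)\in A$ for each $f\in F$. $J(\mathbb{N})=\{p\in\beta\mathbb{N}:\text{every }A\in p\text{ is a }J\text{-set}\}$. A set $A\subseteq\mathbb{N}$ is a $C$-set if $A\in p$ for some idempotent $p\in J(\mathbb{N})$; it is a $C^{\star}$-set if it meets every $C$-set (equivalently, it belongs to every idempotent in $J(\mathbb{N})$). Weak mixing (the paper's definition): $(X,\mathcal{B},\mu,T)$ is weak mixing iff for every $\epsilon>0$ and all $A,B\in\mathcal{B}$, the set $N_\epsilon(A,B)$ is a central$^{\star}$-set. *)

(* Defs.v *)
From HB Require Import structures.
From mathcomp Require Import all_boot all_order all_algebra finmap.
From mathcomp Require Import all_classical all_reals all_analysis.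

Set Implicit Arguments.
Unset Strict Implicit.
Unset Printing Implicit Defensive.

Import Order.TTheory GRing.Theory Num.Theory.

Local Open Scope classical_set_scope.

Record posnat := PosNat { nat_of_posnat :> nat; _ : (0 < nat_of_posnat)%N }.

HB.instance Definition _ := [isSub for nat_of_posnat].
HB.instance Definition _ := [Countable of posnat by <:].

Lemma posnat_addn_gt0 (a : posnat) (k : nat) : (0 < a + k)%N.
Proof. by rewrite ltn_addr //; case: a. Qed.

(* The second summand is a natural number, so that it can also be a finite
   sum; addition of positive integers is the case where it coerces from
   [posnat]. *)
Definition posnat_addn (a : posnat) (k : nat) : posnat :=
  PosNat (posnat_addn_gt0 a k).

(* -x + A *)
Definition shift (x : posnat) (A : set posnat) : set posnat :=
  [set y : posnat | A (posnat_addn x y)].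

Record betaN := BetaN {
  betaN_mem :> set posnat -> Prop;
  betaN_ultra : UltraFilter betaN_mem }.

Definition ultra_add_mem (p q : betaN) : set_system posnat :=
  [set A | p [set x | q (shift x A)]].

Lemma ultra_add_ultra (p q : betaN) : UltraFilter (ultra_add_mem p q).
Proof.
have [pU qU] := (betaN_ultra p, betaN_ultra q).
have add_proper : ProperFilter (ultra_add_mem p q).
  apply: Build_ProperFilter_ex => [A pA|].
    have [x qxA] := @filter_ex _ p _ _ pA.
    by have [y Ay] := @filter_ex _ q _ _ qxA; exists (posnat_addn x y).
  split.
  - apply: (@filterS _ p _ setT); last exact: filterT.
    by move=> x _; apply: filterT.
  - move=> A B pA pB.
    apply: (@filterS _ p _ _ _ _ (@filterI _ p _ _ _ pA pB)) => x [qA qB].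
    exact: (@filterI _ q).
  - move=> A B AB; apply: (@filterS _ p) => x; apply: (@filterS _ q) => y.
    exact: AB.
split=> // G GF addG; rewrite eqEsubset; split=> // A GA.
have [//|pnA] := in_ultra_setVsetC [set x | q (shift x A)] pU.
suff /addG GnA : ultra_add_mem p q (~` A).
  by have [x []] := filter_ex (filterI GA GnA).
apply: (@filterS _ p _ _ _ _ pnA) => x nqA.
by have [/nqA|] := in_ultra_setVsetC (shift x A) qU.
Qed.

Definition ultra_add (p q : betaN) : betaN := BetaN (ultra_add_ultra p q).

Definition idempotent_ultra (p : betaN) : Prop := ultra_add p p = p.

Definition two_sided_ideal (I : set betaN) : Prop :=
  I !=set0 /\ forall p q, I p -> I (ultra_add p q) /\ I (ultra_add q p).

(* K(betaN): the smallest two-sided ideal, when it exists, is the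
   intersection of all of them. *)
Definition smallest_ideal : set betaN :=
  \bigcap_(I in [set I | two_sided_ideal I]) I.

Definition central (A : set posnat) : Prop :=
  exists p : betaN, [/\ idempotent_ultra p, smallest_ideal p & p A].

Definition central_star (A : set posnat) : Prop :=
  forall B, central B -> A `&` B !=set0.

Definition J_set (A : set posnat) : Prop :=
  forall F : set (posnat -> posnat), finite_set F -> F !=set0 ->
  exists (a : posnat) (H : {fset posnat}), H != fset0 /\
    forall f, F f -> A (posnat_addn a (\sum_(n <- H) f n)%N).

Definition J_ultra : set betaN := [set p | forall A, p A -> J_set A].

Definition C_set (A : set posnat) : Prop :=
  exists p : betaN, [/\ idempotent_ultra p, J_ultra p & p A].

Definition C_star (A : set posnat) : Prop :=
  forall B, C_set B -> A `&` B !=set0.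

Definition measure_preserving d (X : measurableType d) (R : realType)
    (mu : probability X R) (T : X -> X) : Prop :=
  forall B, measurable B ->
    measurable (T @^-1` B) /\ mu (T @^-1` B) = mu B.

(* N_eps(A, B) *)
Definition mixing_times d (X : measurableType d) (R : realType)
    (mu : probability X R) (T : X -> X) (eps : R) (A B : set X) : set posnat :=
  [set n : posnat |
    (`|mu (A `&` (iter n T @^-1` B)) - mu A * mu B| < eps%:E)%E].

Definition weak_mixing d (X : measurableType d) (R : realType)
    (mu : probability X R) (T : X -> X) : Prop :=
  forall eps : R, (0 < eps)%R ->
  forall A B, measurable A -> measurable B ->
  central_star (mixing_times mu T eps A B).

(* Main.v *)
(* If all [N_eps(A, B)] are C-star sets they are central-star sets, because
   [J_ultra] is a two-sided ideal and hence contains the smallest one.  That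
   [J_ultra] is nonempty amounts to the positive integers not being a finite
   union of sets that are not J-sets, which follows from the IP van der Waerden
   theorem.

   Conversely suppose that a J-set [D] misses [N_eps(A, B)], and fix an
   idempotent [q] of the smallest ideal.  Weak mixing puts
   [E = N_delta(B, B)] in [q], so [E] contains all finite sums of a sequence
   [x].  Applying the J-set property to functions [f_0 < f_1 < ... < f_m] whose
   increments are sums over disjoint blocks of [x] yields [n_0 < ... < n_m] in
   [D] with all differences in [E].  The sets [T^-n_i B] are then almost
   pairwise independent while each of them is correlated with [A]; Bessel's
   inequality forbids this for large [m]. *)

From mathcomp Require Import all_boot all_order all_algebra finmap.
From mathcomp Require Import all_classical all_reals all_analysis.
From mathcomp Require Import zify lra ring.
Require Import Defs.

Set Implicit Arguments.
Unset Strict Implicit.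
Unset Printing Implicit Defensive.

Import Order.TTheory GRing.Theory Num.Theory.

Local Open Scope classical_set_scope.

#[local] Existing Instance betaN_ultra.

(** * Ultrafilters on the positive integers *)

Lemma betaN_ext (p q : betaN) : (forall A, p A -> q A) -> p = q.
Proof.
case: p q => [p pU] [q qU] /= pq.
have {}pq : q = p by exact: max_filter.
by subst q; congr BetaN; exact: Prop_irrelevance.
Qed.

Lemma betaN_setC (p : betaN) (A : set posnat) : ~ p A -> p (~` A).
Proof. by have [|] := in_ultra_setVsetC A (betaN_ultra p). Qed.

Lemma betaN_contra (p : betaN) (A : set posnat) : p A -> p (~` A) -> False.
Proof. by move=> pA pnA; have [x []] := filter_ex (filterI pA pnA). Qed.

Lemma betaN_exists (F : set_system posnat) : ProperFilter F ->
  exists p : betaN, F `<=` p.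
Proof.
by move=> /ultraFilterLemma[G [GU FG]]; exists (BetaN GU).
Qed.

Lemma ultra_addA (p q r : betaN) :
  ultra_add (ultra_add p q) r = ultra_add p (ultra_add q r).
Proof.
apply: betaN_ext => A; apply: (@filterS _ p) => x.
apply: (@filterS _ q) => y; apply: (@filterS _ r) => z.
rewrite /shift /=; congr A.
by apply: val_inj; rewrite /= addnA.
Qed.

(* Closedness for the usual compact topology of [betaN], whose basic open
   sets are the sets [[set p | p A]]. *)
Definition beta_closed (C : set betaN) :=
  forall p : betaN, (forall A, p A -> exists2 q, C q & q A) -> C p.

Definition left_ideal (C : set betaN) :=
  forall p q, C q -> C (ultra_add p q).

Definition subsemigroup (C : set betaN) :=
  forall p q, C p -> C q -> C (ultra_add p q).

Lemma beta_closedT : beta_closed setT.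
Proof. by []. Qed.

Lemma beta_closed_bigcap (G : set (set betaN)) :
  (forall C, G C -> beta_closed C) -> beta_closed (\bigcap_(C in G) C).
Proof.
move=> Gcl p pG C GC; apply: Gcl => // A /pG[q qG qA].
by exists q => //; exact: qG.
Qed.

Lemma beta_closedI (C D : set betaN) :
  beta_closed C -> beta_closed D -> beta_closed (C `&` D).
Proof.
move=> Ccl Dcl p pCD; split; [apply: Ccl|apply: Dcl] => A /pCD[q [? ?] qA];
  by exists q.
Qed.

(** The sets belonging to every ultrafilter of some [C] in the chain form a proper filter;
    closedness puts any ultrafilter extending it into each [C]. *)
Lemma beta_compact (G : set (set betaN)) : G !=set0 ->
  (forall C, G C -> beta_closed C) -> (forall C, G C -> C !=set0) ->
  total_on G subset -> \bigcap_(C in G) C !=set0.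
Proof.
move=> [C0 GC0] Gcl Gne Gtot.
pose F := [set A : set posnat | exists2 C, G C & forall q, C q -> q A].
have FF : ProperFilter F.
  apply: Build_ProperFilter_ex => [A [C /Gne[q Cq] CA]|].
    exact: (@filter_ex _ q) (CA _ Cq).
  split; first by exists C0 => // q _; exact: filterT.
    move=> A B [C GC CA] [D GD DB].
    have [CD|DC] := Gtot _ _ GC GD.
      by exists C => // q Cq; apply: filterI; [exact: CA|exact/DB/CD].
    by exists D => // q Dq; apply: filterI; [exact/CA/DC|exact: DB].
  by move=> A B AB [C GC CA]; exists C => // q /CA; exact: filterS.
have [p Fp] := betaN_exists FF.
exists p => C GC; apply: (Gcl _ GC) => A pA; apply: contrapT => CnA.
apply: (betaN_contra pA); apply: Fp; exists C => // q Cq.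
by apply: betaN_setC => qA; apply: CnA; exists q.
Qed.

(** The abstract [Q] serves for both subsemigroups and left ideals. Asking [C] to meet [L] localises
    the minimal set; with [L] equal to [setT] it only says that [C] is nonempty. *)
Lemma minimal_closed (Q : set betaN -> Prop) (L : set betaN) :
  (forall G : set (set betaN), G `<=` Q -> Q (\bigcap_(C in G) C)) ->
  beta_closed L -> L !=set0 ->
  exists M, [/\ beta_closed M, Q M, (M `&` L) !=set0 &
    forall C, C `<=` M -> beta_closed C -> Q C -> C `&` L !=set0 -> M `<=` C].
Proof.
move=> Qcap Lcl Lne.
pose P C := [/\ beta_closed C, Q C & C `&` L !=set0].
(* Passing to complements turns a maximal element for unions into a minimal one for intersections.
   The empty chain yields [setT], which meets [L]. *)
have [|N [[Ncl QN NL] Nmax]] := @Zorn_bigcup _ [set D | P (~` D)].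
  move=> F FP Ftot /=; rewrite setC_bigcup.
  pose G := [set ~` D | D in F].
  have -> : \bigcap_(D in F) ~` D = \bigcap_(C in G) C.
    by rewrite /G bigcap_image.
  have GP C : G C -> P C by move=> [D FD <-]; exact: FP.
  split.
  - by apply: beta_closed_bigcap => C /GP[].
  - by apply: Qcap => C /GP[].
  - have [[D0 FD0]|F0] := pselect (F !=set0); last first.
      rewrite (_ : G = set0) ?bigcap_set0 ?setTI//.
      by apply/seteqP; split => // C [D FD _]; apply: F0; exists D.
    have G0 : [set C `&` L | C in G] !=set0.
      by exists (~` D0 `&` L); exists (~` D0) => //; exists D0.
    have [| | |p pG] := beta_compact G0.
    + by move=> _ [C /GP[Ccl _ _] <-]; exact: beta_closedI.
    + by move=> _ [C /GP[_ _ CL] <-].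
    + move=> _ _ [_ [D FD <-] <-] [_ [E FE <-] <-].
      by have [DE|ED] := Ftot _ _ FD FE; [right|left];
        apply: setSI; exact: subsetC.
    + exists p; split.
        by move=> C GC; case: (pG (C `&` L)) => //; exists C.
      case: (pG (~` D0 `&` L)) => //.
      by exists (~` D0) => //; exists D0.
exists (~` N); split => // C CN Ccl QC CL.
apply: contrapT => nNC; apply: (Nmax (~` C)); last by rewrite /= setCK; split.
by split; [exact: subsetCr|move=> nCN; apply: nNC; exact: subsetCl].
Qed.

(** For [r] in the closure, [F] collects the sets common to all [p] in [C] with [A] in [p + q], for
    some [A] in [r]. An ultrafilter extending [F] lies in [C] and is sent to [r]. *)
Lemma beta_closed_addr (C : set betaN) (q : betaN) :
  beta_closed C -> beta_closed [set ultra_add p q | p in C].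
Proof.
move=> Ccl r rC.
pose F := [set B : set posnat | exists2 A, r A &
  forall p, C p -> p [set x | q (shift x A)] -> p B].
have FF : ProperFilter F.
  apply: Build_ProperFilter_ex => [B [A /rC[_ [p Cp <-] pqA] AB]|].
    exact: (@filter_ex _ p) (AB _ Cp pqA).
  split; first by exists setT => [|p _ _]; exact: filterT.
    move=> B B' [A rA AB] [A' rA' AB']; exists (A `&` A'); first exact: filterI.
    move=> p Cp pAA'; apply: filterI.
      by apply: AB => //; apply: filterS pAA' => x; apply: filterS => y [].
    by apply: AB' => //; apply: filterS pAA' => x; apply: filterS => y [].
  move=> B B' BB' [A rA AB]; exists A => // p Cp pA.
  exact: filterS (AB _ Cp pA).
have [p Fp] := betaN_exists FF.
exists p.
  apply: Ccl => B pB; apply: contrapT => CB; apply: (betaN_contra pB).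
  apply: Fp; exists setT => [|p' Cp' _]; first exact: filterT.
  by apply: betaN_setC => p'B; apply: CB; exists p'.
by apply/esym/betaN_ext => A rA; apply: Fp; exists A.
Qed.

Lemma beta_closed_fixer (C : set betaN) (q r : betaN) :
  beta_closed C -> beta_closed [set p | C p /\ ultra_add p q = r].
Proof.
move=> Ccl p pC; split.
  by apply: Ccl => A /pC[p' [Cp' _] p'A]; exists p'.
apply/esym/betaN_ext => A rA; apply: contrapT => npA.
have /pC[p' [_ p'qr] p'nA] := betaN_setC npA.
by rewrite -p'qr in rA; exact: (@betaN_contra (ultra_add p' q) A).
Qed.

(** Ellis's argument: for [e] in a minimal closed subsemigroup [M], minimality gives [M + e = M], so
    some [p] in [M] has [p + e = e]. The set of such [p] is again a closed subsemigroup, hence all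
    of [M], and contains [e]. *)
Lemma closed_subsemigroup_idempotent (L : set betaN) :
  beta_closed L -> L !=set0 -> subsemigroup L ->
  exists2 e, L e & idempotent_ultra e.
Proof.
move=> Lcl Lne Lsg.
have [|M [Mcl Msg [e [Me Le]] Mmin]] :=
    @minimal_closed subsemigroup L _ Lcl Lne.
  by move=> G GQ p q pG qG C GC; apply: (GQ C) => //; [exact: pG|exact: qG].
have {Le} ML : M `<=` L.
  have : M `<=` M `&` L; last by move=> + p Mp => /(_ _ Mp)[].
  apply: Mmin; [exact: subIsetl|exact: beta_closedI| |].
    by move=> p q [? ?] [? ?]; split; [exact: Msg|exact: Lsg].
  by exists e.
have [p Mp pe] : [set ultra_add p e | p in M] e.
  apply: (Mmin _ _ _ _ _ e Me).
  - by move=> _ [p Mp <-]; exact: Msg.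
  - exact: beta_closed_addr.
  - move=> _ _ [p Mp <-] [q Mq <-]; exists (ultra_add (ultra_add p e) q).
      by apply: (Msg) => //; exact: Msg.
    by rewrite ultra_addA.
  - exists (ultra_add e e); split; first by exists e.
    by apply: ML; exact: Msg.
exists e; first exact: ML.
suff [] : [set p | M p /\ ultra_add p e = e] e by [].
apply: (Mmin _ _ _ _ _ e Me).
- by move=> ? [].
- exact: beta_closed_fixer.
- move=> r s [Mr re] [Ms se]; split; first exact: Msg.
  by rewrite ultra_addA se.
- by exists p; split => //; exact: ML.
Qed.

(** Take an idempotent [e] in a minimal closed left ideal [L]. For [i] in a two-sided ideal [I], the
    translates of [i + e] form a closed left ideal inside [L], hence equal to [L]; so [e] lies in
    [I]. *)
Lemma smallest_ideal_idempotent : (setT : set betaN) !=set0 ->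
  exists2 e, smallest_ideal e & idempotent_ultra e.
Proof.
move=> bne.
have [|L [Lcl Lid [q [Lq _]] Lmin]] :=
    @minimal_closed left_ideal setT _ beta_closedT bne.
  by move=> G GQ p q qG C GC; apply: (GQ C) => //; exact: qG.
have [e Le ee] : exists2 e, L e & idempotent_ultra e.
  apply: closed_subsemigroup_idempotent => //; first by exists q.
  by move=> ? ? _; exact: Lid.
exists e => // I [[i Ii] Iid].
have Iie : I (ultra_add i e) by have [] := Iid i e Ii.
suff [p _ <-] : [set ultra_add p (ultra_add i e) | p in setT] e.
  by have [] := Iid _ p Iie.
apply: (Lmin _ _ _ _ _ e Le).
- by move=> _ [p _ <-]; apply: (Lid); exact: Lid.
- exact: beta_closed_addr.
- by move=> p _ [r _ <-]; exists (ultra_add p r); rewrite ?ultra_addA.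
- by exists (ultra_add e (ultra_add i e)); split => //; exists e.
Qed.

(** * J-sets *)

(* Colour focusing.  The bound [n], uniform in the colouring, is what allows the
   induction on [k] to be applied to the colouring of [y] by the whole pattern
   of colours on the window [[y, y + n)]. *)
Lemma ip_van_der_waerden (f : nat -> nat -> nat) (k : nat) :
  forall (K : finType) (N : nat), exists n, forall c : nat -> K,
  exists x a (H : seq nat),
    [/\ H != [::], uniq H, all (fun i => N <= i < n) H, maxn x a < n &
      forall j, j < k -> a + \sum_(i <- H) f j i < n /\
                         c (a + \sum_(i <- H) f j i) = c x].
Proof.
elim: k => [|k IHk] K N.
  exists N.+1 => c; exists 0, 0, [:: N]; split => //=.
  by rewrite leqnn ltnSn.
(* Either [a] and [H] serve all of [f 0, ..., f k], or [s] choices of them serve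
   [f 0, ..., f (k - 1)], with distinct colours, and are all sent by [f k] to
   the same point [b]. *)
have fans s : exists n, forall c : nat -> K,
    (exists x a (H : seq nat),
      [/\ H != [::], uniq H, all (fun i => N <= i < n) H, maxn x a < n &
        forall j, j < k.+1 -> a + \sum_(i <- H) f j i < n /\
                              c (a + \sum_(i <- H) f j i) = c x]) \/
    (exists b (C : {set K}), [/\ #|C| = s, b < n &
      forall y, y \in C -> exists a (H : seq nat),
        [/\ H != [::], uniq H, all (fun i => N <= i < n) H,
          a + \sum_(i <- H) f k i = b &
          forall j, j < k -> a + \sum_(i <- H) f j i < n /\
                             c (a + \sum_(i <- H) f j i) = y]]).
  elim: s => [|s [n IHs]].
    exists 1 => c; right; exists 0, finset.set0.
    by split => [|//|y]; rewrite ?cards0// finset.in_set0.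
  (* Indices of [H'] start at [n] or later, so [H'] is disjoint from every [H] of a fan below
     [n]. *)
  have [n' IHn'] := IHk {ffun 'I_n -> K} (maxn N n).
  pose m := n + n' + n' + \sum_(i < n') f k i.
  exists m => c.
  have [x [a' [H' [H'0 uH' rH' xn' eqH']]]] :=
    IHn' (fun y => [ffun u : 'I_n => c (y + u)]).
  have [] := IHs (fun y => c (x + y)).
    move=> [x0 [a [H [H0 uH rH x0n eqH]]]]; left.
    exists (x + x0), (x + a), H; split => //.
    - by apply: sub_all rH => i /andP[-> ?]; rewrite /m; lia.
    - by rewrite /m; lia.
    - move=> j /eqH[lt_n eq_c]; rewrite -addnA eq_c; split => //.
      by rewrite /m; lia.
  move=> [b [C [cardC bn fanC]]].
  (* If the focus already has a colour of the fan, the spoke of that colour also succeeds for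
     [f k]. *)
  have [yC|yNC] := boolP (c (x + b) \in C).
    left; have [a [H [H0 uH rH abH eqH]]] := fanC _ yC.
    exists (x + b), (x + a), H; split => //.
    - by apply: sub_all rH => i /andP[-> ?]; rewrite /m; lia.
    - by rewrite /m; lia.
    - move=> j; rewrite ltnS leq_eqVlt => /predU1P[->|/eqH[lt_n <-]].
        by rewrite -addnA abH; split => //; rewrite /m; lia.
      by rewrite addnA; split => //; rewrite /m; lia.
  have le_fk : \sum_(i <- H') f k i <= \sum_(i < n') f k i.
    rewrite -(big_mkord xpredT (f k)); apply: (uniq_sub_le_big leqnn) => //.
    - by move=> u v; rewrite leq_addr.
    - exact: iota_uniq.
    - move=> i /(allP rH')/andP[_ i_n'].
      by rewrite mem_index_iota.
  (* Old spokes are moved along [H'] without changing colour, since the windows agree; the new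
     colour gets the spoke [H'] based at [a' + b]. *)
  right; exists (a' + b + \sum_(i <- H') f k i), (c (x + b) |: C)%SET; split.
  - by rewrite cardsU1 yNC cardC.
  - by rewrite /m; lia.
  - have c_shift j u : j < k -> u < n ->
        c (a' + \sum_(i <- H') f j i + u) = c (x + u).
      move=> /eqH'[_] /ffunP + u_n => /(_ (Ordinal u_n)).
      by rewrite !ffunE.
    have rm : all (fun i => N <= i < m) H'.
      apply: sub_all rH' => i; rewrite geq_max /m => /andP[/andP[-> _]].
      by lia.
    move=> y; rewrite finset.in_setU1 => /predU1P[->|yC].
      exists (a' + b), H'; split => // j jk.
      rewrite addnAC c_shift//; split => //.
      by have [] := eqH' _ jk; rewrite /m; lia.
    have [a [H [H0 uH rH abH eqH]]] := fanC _ yC.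
    exists (a' + a), (H' ++ H); split.
    + by case: (H') H'0.
    + rewrite cat_uniq uH' uH andbT; apply/hasPn => i /(allP rH)/andP[_ i_n].
      apply/negP => /(allP rH')/andP[+ _].
      by rewrite geq_max => /andP[_]; rewrite leqNgt i_n.
    + rewrite all_cat rm; apply: sub_all rH => i /andP[-> ?].
      by rewrite /m; lia.
    + by rewrite big_cat/= -abH; lia.
    + move=> j jk; have [lt_n <-] := eqH _ jk.
      rewrite -(c_shift j)// big_cat/=; have [? _] := eqH' _ jk; split.
        by rewrite /m; lia.
      by congr c; lia.
have [n fansn] := fans #|K|.+1.
exists n => c; have [//|[b [C [cardC _ _]]]] := fansn c.
by have := max_card (mem C); rewrite cardC ltnn.
Qed.

Lemma not_J_setP (A : set posnat) : ~ J_set A ->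
  exists2 F : set (posnat -> posnat), finite_set F &
  forall (a : posnat) (H : {fset posnat}), H != fset0 ->
  exists2 f, F f & ~ A (posnat_addn a (\sum_(n <- H) f n)%N).
Proof.
move=> nJ; apply: contrapT => nF; apply: nJ => F finF _.
apply: contrapT => naH; apply: nF; exists F => // a H H0.
apply: contrapT => nf; apply: naH; exists a, H; split => // f Ff.
by apply: contrapT => nA; apply: nf; exists f.
Qed.

(** If the [B i] covered, colour each point by some [B i] containing it and apply
    [ip_van_der_waerden] to all the witness families at once: the colour [i] obtained contradicts
    the family [F i]. *)
Lemma not_J_set_cover (k : nat) (B : nat -> set posnat) :
  (forall i, (i < k)%N -> ~ J_set (B i)) ->
  exists x, forall i, (i < k)%N -> ~ B i x.
Proof.
move=> nJ; apply: contrapT => ncov.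
have {}ncov x : exists i : 'I_k, B i x.
  apply: contrapT => nx; apply: ncov; exists x => i ik Bix.
  by apply: nx; exists (Ordinal ik).
have /choice[F FP] (i : nat) : exists F : set (posnat -> posnat),
    (i < k)%N -> finite_set F /\ forall a (H : {fset posnat}), H != fset0 ->
    exists2 f, F f & ~ B i (posnat_addn a (\sum_(n <- H) f n)%N).
  have [ik|_] := ltnP i k; last by exists set0.
  by have [G] := not_J_setP (nJ _ ik); exists G.
have /finite_fsetP[X XE] : finite_set (\bigcup_(i in `I_k) F i).
  by apply: bigcup_finite => // i /FP[].
pose pos (i : nat) : posnat := PosNat (ltn0Sn i).
have pos_inj : injective pos by move=> i j [].
pose f j i : nat := nth id X j (pos i).
have [N] := ip_van_der_waerden f (size X) (option 'I_k) 0.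
pose c x := [pick i : 'I_k | `[< B i (pos x) >]].
move=> /(_ c)[x [a [H [H0 uH _ _ eqH]]]].
have [i ci] : exists i, c x = Some i.
  rewrite /c; case: pickP => [i _|nB]; first by exists i.
  by have [i /asboolP] := ncov (pos x); rewrite nB.
have /(_ (pos a) [fset pos i | i in H]%fset)[|g Fg] := (FP i (ltn_ord i)).2.
  case: (H) H0 => // h s _; apply/fset0Pn; exists (pos h).
  by apply/imfsetP; exists h => //=; rewrite inE eqxx.
apply.
have gX : g \in (X : seq _).
  by have : [set` X] g by rewrite -XE; exists i => //=.
have [|_] := eqH (index g X); first by rewrite index_mem.
rewrite ci /c; case: pickP => // i' /asboolP + [<-].
congr (B _ _); apply: val_inj => /=; rewrite big_imfset/=; last first.
  by move=> ? ? _ _; exact: pos_inj.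
rewrite addSn; congr (_ + _).+1.
by rewrite undup_id//; apply: eq_bigr => j _; rewrite /f nth_index.
Qed.

(** By [not_J_set_cover], complements of sets that are not J-sets generate a proper filter. *)
Lemma J_ultra_nonempty : J_ultra !=set0.
Proof.
pose F := [set A : set posnat | exists k (B : nat -> set posnat),
  (forall i, (i < k)%N -> ~ J_set (B i)) /\
  forall x, (forall i, (i < k)%N -> ~ B i x) -> A x].
have FF : ProperFilter F.
  apply: Build_ProperFilter_ex => [A [k [B [/not_J_set_cover[x Bx] BA]]]|].
    by exists x; exact: BA.
  split; first by exists 0, (fun=> set0).
    move=> A A' [k [B [nJB BA]]] [k' [B' [nJB' BA']]].
    exists (k + k')%N, (fun i => if (i < k)%N then B i else B' (i - k)%N).
    split=> [i ikk'|x nx].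
      by case: ltnP => [/nJB//|ki]; apply: nJB'; rewrite ltn_subLR.
    split; [apply: BA => i ik|apply: BA' => i ik'].
      by have := nx i; rewrite ik ltn_addr//; exact.
    have := nx (k + i)%N; rewrite ltn_add2l ik' ltnNge leq_addr/= addKn.
    exact.
  by move=> A A' AA' [k [B [nJB BA]]]; exists k, B; split => // x /BA /AA'.
have [p Fp] := betaN_exists FF.
exists p => A pA; apply: contrapT => nJA; apply: (betaN_contra pA).
by apply: Fp; exists 1, (fun=> A); split => // x /(_ 0 isT).
Qed.

(** For [p + q], finitely many members of [q] share a point [y], which is added to [a]. For [q + p],
    some shift of [A] by [x] lies in [p], and [x] is added to [a]. *)
Lemma J_ultra_ideal : two_sided_ideal J_ultra.
Proof.
split=> [|p q pJ]; first exact: J_ultra_nonempty.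
split=> A.
  move=> /pJ JA F finF F0; have [a [H [H0 aHA]]] := JA F finF F0.
  have [X XE] : exists X : {fset posnat -> posnat}, F = [set` X].
    exact/finite_fsetP.
  have : q (\bigcap_(f in F) shift (posnat_addn a (\sum_(n <- H) f n)%N) A).
    by rewrite XE; apply: filter_bigI => f fX; apply: aHA; rewrite XE.
  move=> /(@filter_ex _ q)[y yA].
  exists (posnat_addn a y), H; split => // f /yA.
  by congr A; apply: val_inj => /=; rewrite addnAC.
move=> /(@filter_ex _ q)[x /pJ JA] F finF F0.
have [a [H [H0 aHA]]] := JA F finF F0.
exists (posnat_addn x a), H; split => // f /aHA.
by congr A; apply: val_inj => /=; rewrite addnA.
Qed.

(** Galvin's construction: every [E n] stays in [p], and sums whose least index is [n] lie in [E n].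
    Sorting [s] brings the least index to the front. *)
Lemma idempotent_finite_sums (p : betaN) (A : set posnat) :
  idempotent_ultra p -> p A ->
  exists x : nat -> posnat, forall (s : seq nat) (y : posnat),
    uniq s -> s != [::] -> val y = (\sum_(i <- s) x i)%N -> A y.
Proof.
move=> pp pA.
have /choice[g gP] (B : set posnat) :
    exists x, p B -> B x /\ p (shift x B).
  have [pB|npB] := pselect (p B); last by exists (PosNat (ltn0Sn 0)).
  have ppB : p [set x | p (shift x B)] by move: (pB); rewrite -{1}pp.
  by have [x Bx] := filter_ex (filterI pB ppB); exists x.
pose E n := iter n (fun B => B `&` shift (g B) B) A.
have pE n : p (E n).
  by elim: n => [//|n IHn]; apply: filterI => //; have [] := gP _ IHn.
have leE n m : (n <= m)%N -> E m `<=` E n.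
  by move=> /subnK <-; elim: (m - n)%N => // k IHk x [/IHk].
have Esum s n : path ltn n s ->
    E n (posnat_addn (g (E n)) (\sum_(i <- s) g (E i))%N).
  elim: s n => [|m s IHs] n /=.
    move=> _; have [+ _] := gP _ (pE n); congr (E n _).
    by apply: val_inj; rewrite /= big_nil addn0.
  move=> /andP[nm /IHs/(leE _ _ nm)[_]]; congr (E n _).
  by apply: val_inj; rewrite /= big_cons.
exists (g \o E) => s y us s0 ys; apply: (leE 0 0) => //.
have ss := sort_sorted leq_total s.
have : sorted ltn (sort leq s) by rewrite ltn_sorted_uniq_leq sort_uniq us.
have : (\sum_(i <- s) g (E i) = \sum_(i <- sort leq s) g (E i))%N.
  by apply: perm_big; rewrite perm_sym perm_sort.
have : sort leq s != [::] by rewrite -size_eq0 size_sort size_eq0.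
case: (sort leq s) => // n s' _ sum_eq /Esum/(leE _ _ (leq0n n)).
congr (E 0 _); apply: val_inj => /=.
by rewrite ys /= sum_eq big_cons.
Qed.

Lemma J_set_differences (p : betaN) (E D : set posnat) (m : nat) :
  idempotent_ultra p -> p E -> J_set D ->
  exists n : nat -> posnat, (forall i, (i <= m)%N -> D (n i)) /\
    forall i j, (i < j <= m)%N ->
    exists2 k : posnat, E k & n j = n i + k :> nat.
Proof.
move=> pp pE JD; have [x xP] := idempotent_finite_sums pp pE.
(* [choice.pickle] gives each pair [(n, l)] its own term of [x], so increments at distinct [n] share
   no term. The successor keeps [f 0] positive and cancels in differences. *)
pose f i (n : posnat) : posnat :=
  PosNat (ltn0Sn (\sum_(0 <= l < i) x (choice.pickle (n, l)))).
have [||a [H [H0 aH]]] := JD [set f i | i in `I_m.+1].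
- exact: finite_image.
- by exists (f 0); exists 0.
exists (fun i => posnat_addn a (\sum_(n <- H) f i n)%N); split.
  by move=> i im; apply: aH; exists i.
move=> i j /andP[ij jm].
pose k := (\sum_(n <- H) \sum_(i <= l < j) x (choice.pickle (n, l)))%N.
have k_gt0 : (0 < k)%N.
  case/fset0Pn: H0 => h hH; rewrite /k (big_fsetD1 h)//= ltn_addr//.
  by rewrite big_ltn// ltn_addr//; case: (x _).
exists (PosNat k_gt0).
  apply: (xP [seq choice.pickle (n, l) | n <- H, l <- index_iota i j]).
  - apply: allpairs_uniq; [exact: fset_uniq|exact: iota_uniq|].
    by move=> [? ?] [? ?] _ _ /(pcan_inj choice.pickleK).
  - case/fset0Pn: H0 => h hH; apply/eqP => s0.
    have : choice.pickle (h, i) \in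
        [seq choice.pickle (n, l) | n <- H, l <- index_iota i j].
      by apply: allpairs_f => //; rewrite mem_index_iota leqnn.
    by rewrite s0.
  - by rewrite /= big_allpairs_dep.
rewrite /= -addnA; congr (_ + _)%N; rewrite /k -big_split/=.
apply: eq_bigr => n _; rewrite addSn; congr _.+1.
by rewrite (@big_cat_nat _ _ _ i)// ltnW.
Qed.

(** * Weak mixing *)

Section bessel.
Context d (X : measurableType d) (R : realType) (mu : probability X R).
Local Open Scope ring_scope.

Let mf (A : set X) : R := fine (mu A).

Lemma prob_fineK (A : set X) : measurable A -> (mf A)%:E = mu A.
Proof. by move=> mA; rewrite /mf fineK// fin_num_measure. Qed.

Lemma prob_fine_ge0 (A : set X) : 0 <= mf A.
Proof. exact: fine_ge0. Qed.

Lemma prob_fine_le1 (A : set X) : measurable A -> mf A <= 1.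
Proof. by move=> mA; rewrite -lee_fin prob_fineK// probability_le1. Qed.

(** The form is the integral of the square of the combination of the indicators of [C i] with
    weights [w i]. *)
Lemma gram_ge0 (I : Type) (s : seq I) (w : I -> R) (C : I -> set X) :
  (forall i, measurable (C i)) ->
  0 <= \sum_(i <- s) \sum_(j <- s) w i * w j * mf (C i `&` C j).
Proof.
move=> mC; pose J := [seq (i, j) | i <- s, j <- s].
have mCC k : measurable (C k.1 `&` C k.2) by exact: measurableI.
pose h (k : I * I) x : \bar R :=
  ((w k.1 * w k.2)%:E * (\1_(C k.1 `&` C k.2) x)%:E)%E.
have -> : \sum_(i <- s) \sum_(j <- s) w i * w j * mf (C i `&` C j) =
    fine (\int[mu]_x (\sum_(k <- J) h k x)%E)%E.
  rewrite integral_sum//; last first.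
    by move=> k; apply: integrableZl => //; exact: integrable_indic.
  rewrite (eq_bigr (fun k => (w k.1 * w k.2 * mf (C k.1 `&` C k.2))%:E)).
    by rewrite sumEFin big_allpairs_dep.
  move=> k _; rewrite integralZl//; last exact: integrable_indic.
  by rewrite integral_indic// setIT [RHS]EFinM prob_fineK.
apply/fine_ge0/integral_ge0 => x _.
have -> : (\sum_(k <- J) h k x)%E = ((\sum_(i <- s) w i * \1_(C i) x) ^+ 2)%:E.
  rewrite (eq_bigr (fun k =>
    (w k.1 * \1_(C k.1) x * (w k.2 * \1_(C k.2) x))%:E)); last first.
    by move=> k _; rewrite /h -EFinM indicI/= mulrACA.
  rewrite sumEFin big_allpairs_dep/= expr2 mulr_suml; congr EFin.
  by apply: eq_bigr => i _; rewrite mulr_sumr.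
by rewrite lee_fin sqr_ge0.
Qed.

(* The variance of [S = \sum_i s_i (1_(B_i) - b)], with [s_i] the sign of
   [mu (A `&` B_i) - mu A * b], dominates the square of the integral of [S]
   over [A]. *)
Lemma uncorrelated_sets_bound (n : nat) (A : set X) (B : 'I_n -> set X)
    (b eps delta : R) :
  measurable A -> (forall i, measurable (B i)) -> (forall i, mf (B i) = b) ->
  0 <= eps -> 0 <= delta ->
  (forall i j, i != j -> `|mf (B i `&` B j) - b * b| <= delta) ->
  (forall i, eps <= `|mf (A `&` B i) - mf A * b|) ->
  (n%:R * eps) ^+ 2 <= n%:R + n%:R ^+ 2 * delta.
Proof.
move=> mA mB muB eps0 delta0 corrB corrA.
pose a := mf A; pose e i := mf (A `&` B i).
pose s i := Num.sg (e i - a * b); pose S := \sum_i s i.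
pose t := \sum_i s i * (e i - a * b).
have tE : t = \sum_i `|e i - a * b|.
  by apply: eq_bigr => i _; rewrite /s normrEsg.
have t_ge : n%:R * eps <= t.
  rewrite tE -[n in n%:R]card_ord -sumr_const mulr_suml.
  by apply: ler_sum => i _; rewrite mul1r; exact: corrA.
pose V := \sum_i \sum_j s i * s j * (mf (B i `&` B j) - b * b).
have V_le : V <= n%:R + n%:R ^+ 2 * delta.
  have -> : n%:R + n%:R ^+ 2 * delta =
      \sum_(i < n) \sum_(j < n) ((i == j)%:R + delta).
    rewrite (eq_bigr (fun=> 1 + n%:R * delta)).
      by rewrite sumr_const card_ord -[RHS]mulr_natl; ring.
    move=> i _; rewrite big_split/= sumr_const card_ord mulr_natl; congr +%R.
    rewrite (bigD1 i)//= eqxx big1 ?addr0// => j.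
    by rewrite eq_sym => /negbTE->.
  rewrite /V. apply: ler_sum => i _; apply: ler_sum => j _.
  apply: (le_trans (ler_norm _)); rewrite !normrM.
  have s_le1 k : `|s k| <= 1 by rewrite normr_sg; case: (_ != _).
  apply: (@le_trans _ _ `|mf (B i `&` B j) - b * b|).
    by rewrite ler_piMl// mulr_ile1.
  have [->|ij] := eqVneq i j; last by rewrite add0r; exact: corrB.
  rewrite setIid muB ler_wpDr//.
  have := prob_fine_ge0 (B j); have := prob_fine_le1 (mB j); rewrite muB.
  by rewrite ler_norml /= => *; apply/andP; split; nra.
(* These weights encode the sum of [s i * (1_(B i) - b)], minus [t * 1_A]; here [S] is just the sum
   of the signs. The integral of the square is [V - 2 * t ^+ 2 + t ^+ 2 * a], so [t ^+ 2 <= V]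
   because [a <= 1]. *)
pose w (k : option (option 'I_n)) : R :=
  if k is Some k' then (if k' is Some i then s i else - t) else - (b * S).
pose C (k : option (option 'I_n)) : set X :=
  if k is Some k' then (if k' is Some i then B i else A) else setT.
have mC k : measurable (C k).
  by case: k => [[i|]|] /=; [exact: mB|exact: mA|exact: measurableT].
have := @gram_ge0 _
  (None :: Some None :: [seq Some (Some i) | i <- index_enum 'I_n]) w C mC.
rewrite !big_cons !big_map /=.
under [X in _ + (_ + X)]eq_bigr do rewrite !big_cons !big_map/=.
rewrite !big_split/= !setTI !setIT !setIid.
pose P := \sum_i s i * e i.
have tP : t = P - S * (a * b).
  by rewrite /S mulr_suml -sumrB; apply: eq_bigr => i _; rewrite mulrBr.
have VE : \sum_i \sum_j s i * s j * mf (B i `&` B j) = V + (S * b) ^+ 2.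
  rewrite /S expr2 !mulr_suml -big_split/=; apply: eq_bigr => i _.
  by rewrite mulr_sumr -big_split/=; apply: eq_bigr => j _; ring.
have sb (c : R) : \sum_i c * s i * mf (setT `&` B i) = c * (S * b).
  rewrite /S mulr_suml mulr_sumr; apply: eq_bigr => i _.
  by rewrite setTI muB mulrA.
have sb' (c : R) : \sum_i s i * c * mf (B i `&` setT) = c * (S * b).
  by rewrite -sb; apply: eq_bigr => i _; rewrite setIC [s i * c]mulrC.
have se (c : R) : \sum_i c * s i * mf (A `&` B i) = c * P.
  by rewrite /P mulr_sumr; apply: eq_bigr => i _; rewrite mulrA.
have se' (c : R) : \sum_i s i * c * mf (B i `&` A) = c * P.
  by rewrite -se; apply: eq_bigr => i _; rewrite setIC [s i * c]mulrC.
have mf1 : mf setT = 1 by rewrite /mf probability_setT.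
rewrite VE sb sb' se se' mf1.
have a1 : a <= 1 by exact: prob_fine_le1.
rewrite -/a => V_ge.
apply: le_trans V_le; apply: (@le_trans _ _ (t ^+ 2)).
  rewrite ler_sqr// nnegrE ?mulr_ge0//.
  by apply: le_trans t_ge; rewrite mulr_ge0.
have : t ^+ 2 * a <= t ^+ 2 by rewrite ler_piMr// sqr_ge0.
have PE : P = t + S * (a * b) by rewrite tP subrK.
by move: V_ge; rewrite PE; nra.
Qed.
End bessel.

Lemma iter_preserving d (X : measurableType d) (R : realType)
    (mu : probability X R) (T : X -> X) (n : nat) (B : set X) :
  measure_preserving mu T -> measurable B ->
  measurable (iter n T @^-1` B) /\ mu (iter n T @^-1` B) = mu B.
Proof.
move=> hT mB; elim: n => [//|n [mn <-]].
rewrite (_ : iter n.+1 T @^-1` B = T @^-1` (iter n T @^-1` B)).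
  exact: hT.
by apply/seteqP; split => x; rewrite /preimage /= -iterSr.
Qed.

Lemma mixing_timesP d (X : measurableType d) (R : realType)
    (mu : probability X R) (T : X -> X) (eps : R) (A B : set X) (n : posnat) :
  measure_preserving mu T -> measurable A -> measurable B ->
  mixing_times mu T eps A B n <->
  (`|fine (mu (A `&` (iter n T @^-1` B))) - fine (mu A) * fine (mu B)|
     < eps)%R.
Proof.
move=> hT mA mB; have [mTB _] := iter_preserving n hT mB.
rewrite /mixing_times /= -(prob_fineK mu mA) -(prob_fineK mu mB).
by rewrite -(prob_fineK mu (measurableI _ _ mA mTB)).
Qed.

(** [J_ultra] is one of the ideals intersected in [smallest_ideal]. *)
Lemma J_ultra_central (B : set posnat) : central B -> C_set B.
Proof.
by move=> [p [pp Kp pB]]; exists p; split => //; exact: (Kp _ J_ultra_ideal).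
Qed.

Lemma central_star_minimal_idempotent (A : set posnat) (q : betaN) :
  central_star A -> smallest_ideal q -> idempotent_ultra q -> q A.
Proof.
move=> cA Kq qq; apply: contrapT => /betaN_setC qnA.
by have [|x []] := cA (~` A); first by exists q.
Qed.

Theorem theorem1p7 (d : measure_display) (X : measurableType d) (R : realType)
  (mu : probability X R) (T : X -> X) (hT : measure_preserving mu T) :
  weak_mixing mu T <->
  (forall eps : R, (0 < eps)%R ->
   forall A B : set X, measurable A -> measurable B ->
   C_star (mixing_times mu T eps A B)).
Proof.
split=> [wm eps eps0 A B mA mB D [p [pp Jp pD]]|Cs eps eps0 A B mA mB D cD].
  apply: contrapT => noD.
  have JD : J_set D by exact: Jp.
  have [q Kq qq] : exists2 q, smallest_ideal q & idempotent_ultra q.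
    by apply: smallest_ideal_idempotent; exists p.
  (* With [M = m.+1] sets the bound reads [2 * M ^+ 2 * delta <= M + M ^+ 2 * delta], which fails
     once [M * delta > 1]; hence the choice of [m]. *)
  pose delta := (eps ^+ 2 / 2)%R.
  have delta0 : (0 < delta)%R by rewrite divr_gt0 ?exprn_gt0.
  have qE := central_star_minimal_idempotent (wm _ delta0 B B mB mB) Kq qq.
  pose m := (Num.truncn (delta^-1)).
  have [n [nD nE]] := J_set_differences m qq qE JD.
  have mT i : measurable (iter (n i) T @^-1` B).
    by have [] := iter_preserving (n i) hT mB.
  have muT i : mu (iter (n i) T @^-1` B) = mu B.
    by have [] := iter_preserving (n i) hT mB.
  (* With [n j = n i + k], the intersection is the preimage under [iter (n i) T] of [B] met with its
     preimage under [iter k T], and [k] is a mixing time for [B] with itself. *)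
  have corr i j : (i < j <= m)%N ->
      (`|fine (mu (iter (n i) T @^-1` B `&` iter (n j) T @^-1` B)) -
        fine (mu B) * fine (mu B)| <= delta)%R.
    move=> /nE[k /(mixing_timesP _ _ hT mB mB) + nij] => /ltW.
    have [mk _] := iter_preserving k hT mB.
    have [_ <-] := iter_preserving (n i) hT (measurableI _ _ mB mk).
    congr (`|fine (mu _) - _| <= _)%R; apply/seteqP; split => x;
      by rewrite /preimage/= nij addnC iterD.
  have := @uncorrelated_sets_bound _ _ _ mu m.+1 A
    (fun i => iter (n i) T @^-1` B) (fine (mu B)) eps delta mA.
  move=> /(_ (fun i => mT i) (fun i => congr1 fine (muT i)) (ltW eps0)
    (ltW delta0)) bound.
  have {bound} : ((m.+1%:R * eps) ^+ 2 <= m.+1%:R + m.+1%:R ^+ 2 * delta)%R.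
    apply: bound => [i j|i].
      rewrite neq_ltn => /orP[ij|ji].
        by apply: corr; rewrite ij -ltnS ltn_ord.
      by rewrite setIC; apply: corr; rewrite ji -ltnS ltn_ord.
    rewrite leNgt; apply/negP => /(mixing_timesP _ _ hT mA mB) nN.
    by apply: noD; exists (n i); split => //; apply: nD; rewrite -ltnS.
  have : (delta^-1 < m.+1%:R)%R by exact: truncnS_gt.
  rewrite -[(_^-1 < _)%R](ltr_pM2r delta0) mulVf ?gt_eqF//.
  have eps2 : (eps ^+ 2 = 2 * delta :> R)%R by rewrite /delta; field.
  have : (0 < m.+1%:R :> R)%R by rewrite ltr0n.
  by rewrite exprMn eps2; nra.
exact: (Cs eps eps0 A B mA mB D (J_ultra_central cD)).
Qed.
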